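(* Let $n\ge1$, $\delta>0$, $\beta<n+2$, and let $\nu\in\mathbb{R}^n$. Let $\lambda_1(\nu),\lambda_2(\nu)$ be the eigenvalues of the peridynamic multiplier $M^{\delta,\beta}(\nu)$ and $\lambda_1^{\mathcal N}(\nu),\lambda_2^{\mathcal N}(\nu)$ the eigenvalues of the Navier multiplier $M^{\mathcal N}(\nu)$ on the direction of $\nu$ and on the orthogonal complement of $\nu$, respectively. Then for fixed $\beta$, $$\lim_{\delta\to0^+}\lambda_1(\nu)=-(\lambda^*+\mu)\|\nu\|^2=\lambda_1^{\mathcal N}(\nu),\qquad \lim_{\delta\to0^+}\lambda_2(\nu)=-\mu\|\nu\|^2=\lambda_2^{\mathcal N}(\nu),$$ and for fixed $\delta$, $$\lim_{\beta\to (n+2)^-}\lambda_1(\nu)=-(\lambda^*+\mu)\|\nu\|^2=\lambda_1^{\mathcal N}(\nu),\qquad \lim_{\beta\to (n+2)^-}\lambda_2(\nu)=-\mu\|\nu\|^2=\lambda_2^{\mathcal N}(\nu).$$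
   Context: $\mu,\lambda^*$ are the (real) Lamé parameters. With ${}_pF_q(a_1,\dots,a_p;b_1,\dots,b_q;x)=\sum_{m\ge0}\frac{(a_1)_m\cdots(a_p)_m}{(b_1)_m\cdots(b_q)_m}\frac{x^m}{m!}$, where $(a)_m=a(a+1)\cdots(a+m-1)$ and $(a)_0=1$, set for $\nu\in\mathbb{R}^n$ $$\lambda_1(\nu)=-\|\nu\|^2\Big(3\mu\,{}_3F_4\big(1,\tfrac52,\tfrac{n+2-\beta}{2};2,\tfrac32,\tfrac{n+4}{2},\tfrac{n+4-\beta}{2};-\tfrac14\|\nu\|^2\delta^2\big)+(\lambda^*-\mu)\,{}_1F_2\big(\tfrac{n+2-\beta}{2};\tfrac{n+2}{2},\tfrac{n+4-\beta}{2};-\tfrac14\|\nu\|^2\delta^2\big)^2\Big),$$ $$\lambda_2(\nu)=-\mu\|\nu\|^2\,{}_2F_3\big(1,\tfrac{n+2-\beta}{2};2,\tfrac{n+4}{2},\tfrac{n+4-\beta}{2};-\tfrac14\|\nu\|^2\delta^2\big).$$ The peridynamic multiplier $M^{\delta,\beta}(\nu)$ is the real symmetric $n\times n$ matrix with $M^{\delta,\beta}(\nu)\nu=\lambda_1(\nu)\nu$ and $M^{\delta,\beta}(\nu)w=\lambda_2(\nu)w$ for $w\perp\nu$ (and $M^{\delta,\beta}(0)=0$). The Navier operator $\mathcal N\mathbf u=(\lambda^*+\mu)\nabla(\nabla\cdot\mathbf u)+\mu\Delta\mathbf u$ has Fourier multiplier $M^{\mathcal N}(\nu)=-(\lambda^*+\mu)\nu\otimes\nu-\mu\|\nu\|^2I$,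 where $I$ is the $n\times n$ identity matrix.
   Formalization: The printed value −(λ*+μ)‖ν‖² for λ₁^N(ν) and for both limits of λ₁(ν) is a misprint (false whenever μ≠0 and ν≠0); it is replaced by −(λ*+2μ)‖ν‖², the value that the given definitions yield. *)

(* Defs.v *)
From mathcomp Require Export all_boot all_order all_algebra.
From mathcomp Require Export all_classical all_reals all_analysis.
Export Order.TTheory GRing.Theory Num.Theory.
Export numFieldNormedType.Exports.

Set Implicit Arguments.
Unset Strict Implicit.
Unset Printing Implicit Defensive.

#[global] Open Scope classical_set_scope.
#[global] Open Scope ring_scope.

Section Hypergeometric.
Context {R : realType}.

Definition pochhammer (a : R) (m : nat) : R := \prod_(i < m) (a + i%:R).

Definition pFq_term (a b : seq R) (x : R) : R^nat := fun m =>
  (\prod_(c <- a) pochhammer c m) / (\prod_(c <- b) pochhammer c m)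
    * (x ^+ m / m`!%:R).

(* The numbers p and q of parameters are the lengths of the lists.  [limn] is
   only meaningful for a convergent series; below p <= q and the lower
   parameters are positive as soon as beta < n + 2, so the series converges
   for every x. *)
Definition pFq (a b : seq R) (x : R) : R := limn (series (pFq_term a b x)).

End Hypergeometric.

Section Multipliers.
Context {R : realType} {n : nat}.

(* Euclidean structure: the library norm on matrices is the sup norm. *)
Definition vdot (u v : 'cV[R]_n) : R := \sum_i u i 0 * v i 0.
Definition vnorm (u : 'cV[R]_n) : R := Num.sqrt (vdot u u).

Definition direction (nu : 'cV[R]_n) : set 'cV[R]_n := [set t *: nu | t in setT].
Definition orth_compl (nu : 'cV[R]_n) : set 'cV[R]_n :=
  [set w | vdot w nu = 0].

(* A acts on the subspace V as l times the identity.  This determines l as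
   soon as V <> {0}; it is vacuous for the direction of nu = 0 and, when n = 1,
   for the orthogonal complement of nu <> 0. *)
Definition eigenvalue_on (A : 'M[R]_n) (V : set 'cV[R]_n) (l : R) : Prop :=
  forall v, V v -> A *m v = l *: v.

Definition lambda1 (mu lam delta beta : R) (nu : 'cV[R]_n) : R :=
  let x := - (1 / 4) * (vnorm nu ^+ 2 * delta ^+ 2) in
  - vnorm nu ^+ 2 *
    (3 * mu * pFq [:: 1; 5 / 2; (n%:R + 2 - beta) / 2]
                  [:: 2; 3 / 2; (n%:R + 4) / 2; (n%:R + 4 - beta) / 2] x
     + (lam - mu) * pFq [:: (n%:R + 2 - beta) / 2]
                        [:: (n%:R + 2) / 2; (n%:R + 4 - beta) / 2] x ^+ 2).

Definition lambda2 (mu delta beta : R) (nu : 'cV[R]_n) : R :=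
  let x := - (1 / 4) * (vnorm nu ^+ 2 * delta ^+ 2) in
  - mu * vnorm nu ^+ 2 *
    pFq [:: 1; (n%:R + 2 - beta) / 2]
        [:: 2; (n%:R + 4) / 2; (n%:R + 4 - beta) / 2] x.

Definition is_peridynamic_multiplier (mu lam delta beta : R) (nu : 'cV[R]_n)
    (M : 'M[R]_n) : Prop :=
  [/\ M^T = M,
      M *m nu = lambda1 mu lam delta beta nu *: nu,
      (forall w, vdot w nu = 0 -> M *m w = lambda2 mu delta beta nu *: w) &
      nu = 0 -> M = 0].

(* The only matrix satisfying [is_peridynamic_multiplier]; see
   [peridynamic_multiplierP] and [peridynamic_multiplier_unique].  At nu = 0
   both summands vanish, since there lambda2 = 0 and _ / 0 = 0. *)
Definition peridynamic_multiplier (mu lam delta beta : R) (nu : 'cV[R]_n)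
    : 'M[R]_n :=
  (lambda2 mu delta beta nu)%:M +
  ((lambda1 mu lam delta beta nu - lambda2 mu delta beta nu) / vnorm nu ^+ 2)
    *: (nu *m nu^T).

(* Fourier symbol of (lam + mu) grad div + mu Laplacian;
   nu *m nu^T is the tensor product of nu with itself. *)
Definition navier_multiplier (mu lam : R) (nu : 'cV[R]_n) : 'M[R]_n :=
  - ((lam + mu) *: (nu *m nu^T)) - (mu * vnorm nu ^+ 2)%:M.

Lemma vdot_ge0 (u : 'cV[R]_n) : 0 <= vdot u u.
Proof. by apply: sumr_ge0 => i _; rewrite -expr2 sqr_ge0. Qed.

Lemma vnorm_sqr (u : 'cV[R]_n) : vnorm u ^+ 2 = vdot u u.
Proof. by rewrite sqr_sqrtr // vdot_ge0. Qed.

Lemma vdot_eq0 (u : 'cV[R]_n) : (vdot u u == 0) = (u == 0).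
Proof.
apply/eqP/eqP => [u0|->]; last by apply: big1 => i _; rewrite mxE mul0r.
apply/colP => i; rewrite mxE; apply/eqP; rewrite -sqrf_eq0 expr2; apply/eqP.
by apply: (psumr_eq0P _ u0) => // j _; rewrite -expr2 sqr_ge0.
Qed.

Lemma vdotC (u v : 'cV[R]_n) : vdot u v = vdot v u.
Proof. by apply: eq_bigr => i _; rewrite mulrC. Qed.

Lemma outer_mul (u v w : 'cV[R]_n) : u *m v^T *m w = vdot v w *: u.
Proof.
rewrite -mulmxA; apply/colP => i; rewrite mxE big_ord1 !mxE mulrC.
by congr (_ * _); apply: eq_bigr => j _; rewrite mxE.
Qed.

Lemma peridynamic_multiplierP (mu lam delta beta : R) (nu : 'cV[R]_n) :
  is_peridynamic_multiplier mu lam delta beta nu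
    (peridynamic_multiplier mu lam delta beta nu).
Proof.
rewrite /is_peridynamic_multiplier /peridynamic_multiplier.
set l1 := lambda1 _ _ _ _ _; set l2 := lambda2 _ _ _ _.
split.
- by rewrite linearD linearZ /= tr_scalar_mx trmx_mul trmxK.
- rewrite mulmxDl mul_scalar_mx -scalemxAl outer_mul vnorm_sqr scalerA.
  have [->|nu0] := eqVneq nu 0; first by rewrite !scaler0 addr0.
  by rewrite divfK ?vdot_eq0// -scalerDl addrC subrK.
- move=> w w0; rewrite mulmxDl mul_scalar_mx -scalemxAl outer_mul vdotC w0.
  by rewrite scale0r scaler0 addr0.
- move=> nu0.
  have -> : l2 = 0.
    by rewrite /l2 /lambda2 vnorm_sqr; move/eqP: nu0; rewrite -vdot_eq0 => /eqP ->;
       rewrite mulr0 mul0r.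
  by rewrite nu0 mul0mx scaler0 addr0 raddf0.
Qed.

Lemma peridynamic_multiplier_unique (mu lam delta beta : R) (nu : 'cV[R]_n)
    (M : 'M[R]_n) :
  is_peridynamic_multiplier mu lam delta beta nu M ->
  M = peridynamic_multiplier mu lam delta beta nu.
Proof.
move=> [_ M1 M2 M0].
have [_ P1 P2 P0] := peridynamic_multiplierP mu lam delta beta nu.
have [nu0|nu0] := eqVneq nu 0; first by rewrite M0 // P0.
suff MP (v : 'cV[R]_n) : M *m v = peridynamic_multiplier mu lam delta beta nu *m v.
  apply/matrixP => i j; have /colP/(_ i) := MP (delta_mx j 0).
  by rewrite -!colE !mxE.
set t := vdot v nu / vdot nu nu.
have -> : v = t *: nu + (v - t *: nu) by rewrite addrC subrK.
rewrite !mulmxDr -!scalemxAr M1 P1 -!mulmxDr.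
suff w0 : vdot (v - t *: nu) nu = 0 by rewrite M2 // P2.
have -> : vdot (v - t *: nu) nu = vdot v nu - t * vdot nu nu.
  rewrite /vdot mulr_sumr -sumrB; apply: eq_bigr => i _.
  by rewrite !mxE mulrBl mulrA.
by rewrite /t divfK ?vdot_eq0// subrr.
Qed.

End Multipliers.

(* Main.v *)
Require Import Defs.
From mathcomp Require Import ring lra.

(** Each of the three hypergeometric functions in the eigenvalues equals 1 at
the origin and stays close to 1 in both limiting regimes, for one reason.
With a = (n + 2 - beta) / 2 > 0, the upper parameter a faces the lower
parameter a + 1, and the Pochhammer quotient telescopes to a / (a + m)
([pochhammer_quotient]).  For m >= 1 this is at most a / (a + 1), the remaining
factors of the coefficient being at most 1, so comparing the series term by
term with the exponential series ([pFq_dist1]) gives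

     | F(x) - 1 | <= a / (a + 1) * (exp |x| - 1).

The right-hand side vanishes both when x -> 0, i.e. delta -> 0, and when
a -> 0, i.e. beta -> n + 2, so both regimes are one statement: delta -> d0 and
beta -> b0 along any filter, with d0 = 0 or b0 = n + 2
([pFq_multiplier_cvg1]).  Every hypergeometric function then tends to 1, hence
lambda1 tends to - ||nu||^2 (3 mu + (lam - mu)) and lambda2 to - mu ||nu||^2.
The two Navier eigenvalues are read off a scalar matrix plus a multiple of the
projection onto nu ([navier_mul]); along nu both terms contribute, which gives
- ((lam + mu) + mu) ||nu||^2, the same value as the limit of lambda1. *)

(** * Pochhammer quotients and the coefficients of the series *)

Section Hypergeometric_bounds.
Context {R : realType}.
Implicit Types (a b c q x : R) (m : nat).

Lemma pochhammer_gt0 a m : 0 < a -> 0 < pochhammer a m.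
Proof. by move=> a0; apply: prodr_gt0 => i _; apply: ltr_wpDr. Qed.

Lemma pochhammer_ge1 b m : 1 <= b -> 1 <= pochhammer b m.
Proof.
move=> b1; apply: (big_ind (fun x => 1 <= x)) => // [x y|i _].
  exact: mulr_ege1.
by rewrite -[1]addr0 lerD.
Qed.

(** Both sides are the product of a, a + 1, ..., a + m. *)
Lemma pochhammer_shift a m :
  pochhammer a m * (a + m%:R) = a * pochhammer (a + 1) m.
Proof.
transitivity (pochhammer a m.+1); first by rewrite /pochhammer big_ord_recr.
rewrite /pochhammer big_ord_recl addr0; congr (_ * _); apply: eq_bigr => i _.
by rewrite lift0 -nat1r addrA.
Qed.

Lemma pochhammer_quotient a m : 0 < a ->
  pochhammer a m / pochhammer (a + 1) m = a / (a + m%:R).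
Proof.
move=> a0; apply/eqP; rewrite eqr_div ?pochhammer_shift//.
  by rewrite gt_eqF// pochhammer_gt0// addr_gt0.
by rewrite gt_eqF// ltr_wpDr.
Qed.

Definition pFq_coef (s t : seq R) m : R :=
  (\prod_(c <- s) pochhammer c m) / (\prod_(c <- t) pochhammer c m).

(** The common shape of the coefficients: a faces a + 1, and q stands for the
quotient of the purely numerical parameters. *)
Lemma telescoped_coef_le a b q m : 0 < a -> 1 <= b -> 0 <= q <= 1 -> (0 < m)%N ->
  `|q * (pochhammer a m / pochhammer (a + 1) m) / pochhammer b m| <= a / (a + 1).
Proof.
move=> a0 b1 /andP[q0 q1] m0; rewrite pochhammer_quotient//.
have pb1 : 1 <= pochhammer b m by exact: pochhammer_ge1.
have pb0 : 0 < pochhammer b m by exact: lt_le_trans pb1.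
have am0 : 0 < a + m%:R by rewrite ltr_wpDr.
have t0 : 0 <= a / (a + m%:R) by rewrite divr_ge0 ?ltW.
rewrite ger0_norm; last by apply: divr_ge0; [exact: mulr_ge0 | exact: ltW].
apply: (@le_trans _ _ (a / (a + m%:R))).
  rewrite ler_pdivrMr// (le_trans (ler_piMl t0 q1))//.
  exact: ler_peMr.
rewrite ler_pM2l// lef_pV2 ?posrE ?addr_gt0 ?ltr0n//.
by rewrite lerD2l ler1n.
Qed.

Lemma pochhammer12 m : pochhammer (1 : R) m / pochhammer 2 m = (m.+1%:R)^-1.
Proof. by rewrite pochhammer_quotient// nat1r mul1r. Qed.

Lemma pochhammer52 m :
  pochhammer (5 / 2 : R) m / pochhammer (3 / 2) m = 1 + 2 / 3 * m%:R.
Proof.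
(* the inverse is the quotient for 3 / 2 over 3 / 2 + 1, which telescopes *)
have -> : (5 / 2 : R) = 3 / 2 + 1 by lra.
have m0 : 0 <= m%:R :> R by [].
rewrite -[LHS]invrK invf_div pochhammer_quotient; last by lra.
by field; apply/eqP; lra.
Qed.

Lemma coef1F2_le a b m : 0 < a -> 1 <= b -> (0 < m)%N ->
  `|pFq_coef [:: a] [:: b; a + 1] m| <= a / (a + 1).
Proof.
move=> a0 b1 m0; rewrite /pFq_coef !big_cons !big_nil !mulr1.
have := @telescoped_coef_le a b 1 m a0 b1 _ m0.
rewrite mul1r ler01 lexx => /(_ isT).
by rewrite invfM [_ * (_^-1 * _)]mulrCA [X in `|X|]mulrC.
Qed.

Lemma coef2F3_le a b m : 0 < a -> 1 <= b -> (0 < m)%N ->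
  `|pFq_coef [:: 1; a] [:: 2; b; a + 1] m| <= a / (a + 1).
Proof.
move=> a0 b1 m0; rewrite /pFq_coef !big_cons !big_nil !mulr1.
have := @telescoped_coef_le a b (m.+1%:R)^-1 m a0 b1 _ m0.
rewrite invr_ge0 ler0n invf_le1 ?ltr0n// ler1n => /(_ isT).
rewrite -pochhammer12; congr (`|_| <= _).
by rewrite !invfM; ring.
Qed.

(** The growing quotient of the pair 5/2, 3/2 is absorbed by the decaying one
of the pair 1, 2: (1 + 2 m / 3) / (m + 1) <= 1. *)
Lemma coef3F4_le a b m : 0 < a -> 1 <= b -> (0 < m)%N ->
  `|pFq_coef [:: 1; 5 / 2; a] [:: 2; 3 / 2; b; a + 1] m| <= a / (a + 1).
Proof.
move=> a0 b1 m0; rewrite /pFq_coef !big_cons !big_nil !mulr1.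
have := @telescoped_coef_le a b ((m.+1%:R)^-1 * (1 + 2 / 3 * m%:R)) m a0 b1 _ m0.
have mge0 : 0 <= m%:R :> R by [].
have -> : 0 <= (m.+1%:R)^-1 * (1 + 2 / 3 * m%:R : R) <= 1.
  apply/andP; split; first by rewrite mulr_ge0 ?invr_ge0//; lra.
  by rewrite mulrC ler_pdivrMr// -natr1; lra.
move=> /(_ isT); rewrite -pochhammer12 -pochhammer52.
congr (`|_| <= _).
by rewrite !invfM; ring.
Qed.

(** * Comparison with the exponential series *)

Lemma pFq_termE (s t : seq R) x m :
  pFq_term s t x m = pFq_coef s t m * (x ^+ m / m`!%:R).
Proof. by []. Qed.

Lemma pFq_term0 (s t : seq R) x : pFq_term s t x 0 = 1.
Proof.
have p1 (l : seq R) : \prod_(c <- l) pochhammer c 0 = 1.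
  by apply: big1 => c _; rewrite /pochhammer big_ord0.
by rewrite /pFq_term !p1 expr0 fact0 !divr1 mulr1.
Qed.

Lemma exp_coeff0 x : exp_coeff x 0%N = 1.
Proof. by rewrite /exp_coeff /= expr0 fact0 divr1. Qed.

Lemma norm_pFq_term_le (s t : seq R) x c m : `|pFq_coef s t m| <= c ->
  `|pFq_term s t x m| <= c * exp_coeff `|x| m.
Proof.
move=> sc; rewrite pFq_termE normrM [X in _ * X <= _]normrM normfV normrX normr_nat.
by apply: ler_wpM2r => //; exact: exp_coeff_ge0.
Qed.

(** Term-by-term domination by c times the exponential series, whose term of
index 0 is removed on both sides. *)
Lemma pFq_dist1 (s t : seq R) x c : 0 <= c ->
  (forall m, (0 < m)%N -> `|pFq_coef s t m| <= c) ->
  `|pFq s t x - 1| <= c * (expR `|x| - 1).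
Proof.
move=> c0 sc.
(* the term of index 0 is 1, hence the constant 1 + c *)
have dom m : `|pFq_term s t x m| <= (1 + c) * exp_coeff `|x| m.
  case: m => [|m]; first by rewrite pFq_term0 normr1 exp_coeff0 mulr1 lerDl.
  by apply: norm_pFq_term_le; apply: le_trans (sc m.+1 _) _ => //; rewrite lerDr.
have cvgF : cvgn (series (pFq_term s t x)).
  apply: normed_cvg.
  apply: (@series_le_cvg _ _ ((1 + c) *: exp_coeff `|x|)) dom _.
  - by move=> m; exact: normr_ge0.
  - by move=> m; apply: mulr_ge0; [exact: addr_ge0 | exact: exp_coeff_ge0].
  - by apply: is_cvg_seriesZ; exact: is_cvg_series_exp_coeff.
have tail_le N : `|series (pFq_term s t x) N.+1 - 1| <= c * (expR `|x| - 1).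
  rewrite seriesEnat /= big_nat_recl// pFq_term0 [1 + _]addrC addrK.
  apply: le_trans (ler_norm_sum _ _ _) _.
  apply: (@le_trans _ _ (\sum_(0 <= i < N) c * exp_coeff `|x| i.+1)).
    by apply: ler_sum => i _; exact: norm_pFq_term_le (sc _ _).
  rewrite -mulr_sumr ler_wpM2l// lerBrDl.
  have -> : 1 + \sum_(0 <= i < N) exp_coeff `|x| i.+1
            = series (exp_coeff `|x|) N.+1.
    by rewrite seriesEnat /= big_nat_recl// exp_coeff0.
  apply: (nondecreasing_cvgn_le _ (is_cvg_series_exp_coeff `|x|)).
  by apply: nondecreasing_series => i _ _; exact: exp_coeff_ge0.
have cvg1 : `|series (pFq_term s t x) N.+1 - 1| @[N --> \oo] --> `|pFq s t x - 1|.
  apply: cvg_norm; apply: cvgB; last exact: cvg_cst.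
  by rewrite (cvg_shiftS (series (pFq_term s t x))).
by rewrite -(cvg_lim _ cvg1)//; apply: limr_le; [exact: cvgP cvg1 | exact: nearW].
Qed.

End Hypergeometric_bounds.

(** * Limits along a filter *)

Section Limits.
Context {R : realType} {T : Type} {F : set_system T} {FF : ProperFilter F}.

(** The product condition a0 * x0 = 0 covers both regimes: the argument of the
series tends to 0, or its upper parameter a does.  The parameter lists u and v
are functions of a, as a occurs in both. *)
Lemma pFq_cvg1 (u v : R -> seq R) (a x : T -> R) (a0 x0 : R) :
  (forall (c : R) m, 0 < c -> (0 < m)%N -> `|pFq_coef (u c) (v c) m| <= c / (c + 1)) ->
  a t @[t --> F] --> a0 -> (\forall t \near F, 0 < a t) ->
  x t @[t --> F] --> x0 -> a0 * x0 = 0 ->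
  pFq (u (a t)) (v (a t)) (x t) @[t --> F] --> (1 : R).
Proof.
move=> coef_le cva a_gt0 cvx ax0.
have a0ge0 : 0 <= a0.
  rewrite -(cvg_lim _ cva)//; apply: limr_ge; first exact: cvgP cva.
  by apply: filterS a_gt0 => t /ltW.
have bound0 : a t / (a t + 1) * (expR `|x t| - 1) @[t --> F] --> (0 : R).
  have -> : 0 = a0 / (a0 + 1) * (expR `|x0| - 1).
    move/eqP: ax0; rewrite mulf_eq0 => /orP[] /eqP ->; first by rewrite !mul0r.
    by rewrite normr0 expR0 subrr mulr0.
  apply: cvgM.
    apply: cvgM => //; apply: cvgV; first by rewrite gt_eqF// ltr_wpDl.
    by apply: cvgD => //; exact: cvg_cst.
  apply: cvgB; last exact: cvg_cst.
  by apply: continuous_cvg; [exact: continuous_expR | exact: cvg_norm].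
apply/subr_cvg0; apply: norm_cvg0.
apply: (squeeze_cvgr _ (cvg_cst (0 : R)) bound0).
apply: filterS a_gt0 => t at0; rewrite normr_ge0/=.
apply: pFq_dist1; first by rewrite divr_ge0// ?addr_ge0// ltW.
by move=> m; exact: coef_le.
Qed.

Context {n : nat}.
Variables (delta beta : T -> R) (d0 b0 : R) (nu : 'cV[R]_n).
Hypothesis n_gt0 : (1 <= n)%N.
Hypothesis cvg_delta : delta t @[t --> F] --> d0.
Hypothesis cvg_beta : beta t @[t --> F] --> b0.
Hypothesis beta_lt : \forall t \near F, beta t < n%:R + 2.
Hypothesis regime : d0 = 0 \/ b0 = n%:R + 2.

Let a t := (n%:R + 2 - beta t) / 2.
Let x t := - (1 / 4) * (vnorm nu ^+ 2 * delta t ^+ 2).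

Lemma pFq_multiplier_cvg1 (u v : R -> seq R) :
  (forall (c : R) m, 0 < c -> (0 < m)%N -> `|pFq_coef (u c) (v c) m| <= c / (c + 1)) ->
  pFq (u (a t)) (v (a t)) (x t) @[t --> F] --> (1 : R).
Proof.
move=> coef_le.
apply: (@pFq_cvg1 u v a x ((n%:R + 2 - b0) / 2)
                  (- (1 / 4) * (vnorm nu ^+ 2 * d0 ^+ 2))) => //.
- by apply: cvgM; [apply: cvgB => //|]; exact: cvg_cst.
- by apply: filterS beta_lt => t bt; rewrite /a divr_gt0// subr_gt0.
- apply: cvgM; first exact: cvg_cst.
  by apply: cvgM; [exact: cvg_cst | apply: cvgM].
- by case: regime => ->; rewrite ?expr0n ?mulr0// subrr !mul0r.
Qed.

Let lower_param t : (n%:R + 4 - beta t) / 2 = a t + 1.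
Proof. by rewrite /a; lra. Qed.

Lemma lambda1_cvg mu lam :
  lambda1 mu lam (delta t) (beta t) nu @[t --> F]
    --> - (lam + 2 * mu) * vnorm nu ^+ 2.
Proof.
have n_ge1 : 1 <= n%:R :> R by rewrite ler1n.
have -> : - (lam + 2 * mu) * vnorm nu ^+ 2
        = - vnorm nu ^+ 2 * (3 * mu * 1 + (lam - mu) * (1 * 1)) by ring.
rewrite /lambda1; under eq_fun do rewrite lower_param expr2.
have cvg3F4 := @pFq_multiplier_cvg1 (fun c => [:: 1; 5 / 2; c])
  (fun c => [:: 2; 3 / 2; (n%:R + 4) / 2; c + 1]).
have cvg1F2 := @pFq_multiplier_cvg1 (fun c => [:: c])
  (fun c => [:: (n%:R + 2) / 2; c + 1]).
apply: cvgM; first exact: cvg_cst.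
apply: cvgD; (apply: cvgM; first exact: cvg_cst).
- by apply: cvg3F4 => c m c0; apply: coef3F4_le => //; lra.
- by apply: cvgM; apply: cvg1F2 => c m c0; apply: coef1F2_le => //; lra.
Qed.

Lemma lambda2_cvg mu :
  lambda2 mu (delta t) (beta t) nu @[t --> F] --> - mu * vnorm nu ^+ 2.
Proof.
have n_ge1 : 1 <= n%:R :> R by rewrite ler1n.
rewrite -[X in _ --> X]mulr1 /lambda2; under eq_fun do rewrite lower_param.
apply: cvgM; first exact: cvg_cst.
apply: (@pFq_multiplier_cvg1 (fun c => [:: 1; c])
  (fun c => [:: 2; (n%:R + 4) / 2; c + 1])) => c m c0.
by apply: coef2F3_le => //; lra.
Qed.

End Limits.

(** * Eigenvalues and the conclusion *)

Lemma navier_mul (R : realType) (n : nat) (mu lam : R) (nu v : 'cV[R]_n) :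
  navier_multiplier mu lam nu *m v
  = - ((lam + mu) * vdot nu v) *: nu - (mu * vnorm nu ^+ 2) *: v.
Proof.
by rewrite mulmxBl mulNmx -scalemxAl outer_mul mul_scalar_mx scalerA scaleNr.
Qed.

Theorem corollary1 (R : realType) (n : nat) (mu lam : R) (nu : 'cV[R]_n)
    (hn : (1 <= n)%N) :
  [/\ forall delta beta : R, 0 < delta -> beta < n%:R + 2 ->
        eigenvalue_on (peridynamic_multiplier mu lam delta beta nu)
          (direction nu) (lambda1 mu lam delta beta nu) /\
        eigenvalue_on (peridynamic_multiplier mu lam delta beta nu)
          (orth_compl nu) (lambda2 mu delta beta nu),
      eigenvalue_on (navier_multiplier mu lam nu)
          (direction nu) (- (lam + 2 * mu) * vnorm nu ^+ 2) /\
        eigenvalue_on (navier_multiplier mu lam nu)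
          (orth_compl nu) (- mu * vnorm nu ^+ 2),
      forall beta : R, beta < n%:R + 2 ->
        (lambda1 mu lam delta beta nu @[delta --> 0^'+]
          --> - (lam + 2 * mu) * vnorm nu ^+ 2) /\
        (lambda2 mu delta beta nu @[delta --> 0^'+]
          --> - mu * vnorm nu ^+ 2) &
      forall delta : R, 0 < delta ->
        (lambda1 mu lam delta beta nu @[beta --> (n%:R + 2)^'-]
          --> - (lam + 2 * mu) * vnorm nu ^+ 2) /\
        (lambda2 mu delta beta nu @[beta --> (n%:R + 2)^'-]
          --> - mu * vnorm nu ^+ 2)].

Proof.
split.
- move=> delta beta _ _.
  have [_ Mnu Mw _] := peridynamic_multiplierP mu lam delta beta nu.
  split=> [_ [t _ <-]|w w0]; last exact: Mw.
  by rewrite -scalemxAr Mnu !scalerA mulrC.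
- split=> [_ [t _ <-]|w w0].
    rewrite -scalemxAr navier_mul -vnorm_sqr -scalerBl !scalerA.
    by congr (_ *: _); ring.
  by rewrite navier_mul vdotC w0 mulr0 oppr0 scale0r sub0r mulNr scaleNr.
- move=> beta hbeta.
  have cvgd : delta @[delta --> (0 : R)^'+] --> (0 : R).
    by apply: cvg_within_filter; exact: cvg_id.
  have cvgb : beta @[_ --> (0 : R)^'+] --> beta by exact: cvg_cst.
  have beta_lt : \forall _ \near (0 : R)^'+, beta < n%:R + 2 by exact: nearW.
  have regime : (0 : R) = 0 \/ beta = n%:R + 2 by left.
  split; [exact: (lambda1_cvg _ _ _ _ nu hn cvgd cvgb beta_lt regime)
         |exact: (lambda2_cvg _ _ _ _ nu hn cvgd cvgb beta_lt regime)].
- move=> delta hdelta.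
  have cvgd : delta @[_ --> (n%:R + 2 : R)^'-] --> delta by exact: cvg_cst.
  have cvgb : beta @[beta --> (n%:R + 2 : R)^'-] --> (n%:R + 2 : R).
    by apply: cvg_within_filter; exact: cvg_id.
  have beta_lt : \forall beta \near (n%:R + 2 : R)^'-, beta < n%:R + 2.
    exact: withinT.
  have regime : delta = 0 \/ (n%:R + 2 : R) = n%:R + 2 by right.
  split; [exact: (lambda1_cvg _ _ _ _ nu hn cvgd cvgb beta_lt regime)
         |exact: (lambda2_cvg _ _ _ _ nu hn cvgd cvgb beta_lt regime)].
Qed.
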